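(* Assume that $u_0,v_0,w_0\in D(\mathcal L^{1/2})$. Then the initial energy $$E_1=\frac12\left\|\frac{u_1-u_0}{\tau}\right\|^2+\frac{\alpha_0}{2}(V_0+V_1)+\frac{\beta_0}{2}(V_0^2+V_1^2),\qquad V_k=\frac12\|\mathcal L^{1/2}u_k\|^2,$$ admits a bound that is uniform in $\tau$ (although $E_1$ itself depends on $\tau$ through $u_1$). Moreover, there are positive constants $M_1$ and $M_2$, depending only on $u_0,v_0,w_0$, on $\alpha$, $\beta$, $T$ and on $\max_{0\le t\le T}\|f(t)\|$, and hence independent of $\tau$, such that for every integer $n>1$, with $\tau=T/n$, and every solution sequence $u_0,u_1,\dots,u_n$ of the nonlinear scheme, the inequalities $$\left\|\frac{u_k-u_{k-1}}{\tau}\right\|\le M_1\qquad\text{and}\qquad \|\mathcal L^{1/2}u_k\|\le M_2$$ hold for every $k=1,2,\dots,n$.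
   Context: $\Omega\subset\mathbb R^2$ is a bounded convex domain; $\|\cdot\|$ is the norm of $L^2(\Omega)$. $\mathcal L$ is the Friedrichs extension of $-\Delta$ with domain $\{u\in C^2(\overline\Omega):u|_{\partial\Omega}=0\}$, i.e. the unique self-adjoint positive definite operator in $L^2(\Omega)$ associated with the form $a(u,v)=(\nabla u,\nabla v)$ on $H^1_0(\Omega)$; $D(\mathcal L^{1/2})=H_0^1(\Omega)$, $\|\mathcal L^{1/2}u\|=\|\nabla u\|$, and powers of $\mathcal L$ are defined by the spectral calculus. $T>0$; $\alpha,\beta\in C^1([0,T])$ are real-valued with $\min_{[0,T]}\alpha>0$ and $\min_{[0,T]}\beta>0$; $f\in C([0,T];L^2(\Omega))$. For an integer $n>1$, $\tau=T/n$, $t_k=k\tau$, $\alpha_k=\alpha(t_k)$, $\beta_k=\beta(t_k)$, $f_k=f(t_k)$. The initial data are $u_0$ (initial displacement) and $v_0$ (initial velocity), and $$w_0=f_0+q_0\Delta u_0,\qquad q_0=\alpha_0+\beta_0\iint_\Omega|\nabla u_0|^2\,dx\,dy,\qquad u_1=u_0+\tau v_0+\frac{\tau^2}{2}w_0 .$$ Here $\Delta u_0$ is understood in the distributional sense, i.e. $w_0=f_0-q_0\mathcal L u_0$ (with $u_0\in D(\mathcal L)$, which is implied by $w_0\in L^2(\Omega)$). A solution sequence of the nonlinear scheme is a sequence $u_0,\dots,u_n\in D(\mathcal L)$ with these $u_0$, $u_1$ and, for $k=1,\dots,n-1$, $$\frac{u_{k+1}-2u_k+u_{k-1}}{\tau^2}+\frac12\left(\alpha_k+\frac{\beta_k}{2}\left(\|\mathcal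 L^{1/2}u_{k+1}\|^2+\|\mathcal L^{1/2}u_{k-1}\|^2\right)\right)\left(\mathcal L u_{k+1}+\mathcal L u_{k-1}\right)=f_k .$$ *)

(* Defs.v *)
From HB Require Import structures.
From mathcomp Require Import all_boot all_order all_algebra.
From mathcomp Require Import all_classical all_reals all_analysis.
From mathcomp Require Import measurable_realfun.

Set Implicit Arguments.
Unset Strict Implicit.
Unset Printing Implicit Defensive.
Import Order.TTheory GRing.Theory Num.Theory.
Import numFieldNormedType.Exports.

Local Open Scope classical_set_scope.
Local Open Scope ring_scope.

(* The plane occurs both as the normed space R * R and as the measurable space
   mplane R, which carries the product Borel sigma-algebra; the two types are
   convertible. *)
Definition mplane (R : realType) := (measurableTypeR R * measurableTypeR R)%type.

Record bounded_convex_domain (R : realType) := BoundedConvexDomain {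
  region :> set (R * R) ;
  region_open : open region ;
  region_nonempty : region !=set0 ;
  region_bounded : bounded_set region ;
  region_convex : convex_set (region : set (convex_lmodType (R * R)%type)) }.

Lemma open_measurable_plane (R : realType) (A : set (R * R)) :
  open A -> measurable (A : set (mplane R)).
Proof.
move=> oA.
pose box (i : rat * rat * nat) : set (mplane R) :=
  [set x : R | ball (ratr i.1.1 : R) i.2.+1%:R^-1 x] `*`
  [set x : R | ball (ratr i.1.2 : R) i.2.+1%:R^-1 x].
pose F (i : rat * rat * nat) : set (mplane R) :=
  if `[< box i `<=` A >] then box i else set0.
have -> : (A : set (mplane R)) = \bigcup_i F i.
  apply/seteqP; split => [[x y] Axy|p [i _]]; last first.
    by rewrite /F; case: ifPn => // /asboolP; exact.
  have [e /= e0 eA] : exists2 e : R, 0 < e & ball (x, y) e `<=` A.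
    by have /nbhs_ballP[e e0 eA] := open_nbhs_nbhs (conj oA Axy); exists e.
  have [n ne] : exists n, n.+1%:R^-1 < e / 2.
    have e20 : 0 < e / 2 by rewrite divr_gt0.
    have [n _ /(_ n (leqnn n)) /= ?] := near_infty_natSinv_lt (PosNum e20).
    by exists n.
  have n0 : 0 < n.+1%:R^-1 :> R by rewrite invr_gt0.
  have approx (z : R) : exists q : rat, ball (ratr q : R) n.+1%:R^-1 z.
    have [|q] := @rat_in_itvoo R (z - n.+1%:R^-1) (z + n.+1%:R^-1).
      by rewrite ltrD2l (lt_trans _ n0)// oppr_lt0.
    by rewrite in_itv/= -ltr_distl => zq; exists q.
  have [p xp] := approx x; have [q yq] := approx y.
  exists (p, q, n) => //; rewrite /F asboolT; first by split.
  move=> [a b] [/= pa qb]; apply: eA.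
  have tri (z w r : R) : ball r n.+1%:R^-1 z -> ball r n.+1%:R^-1 w -> ball z e w.
    move=> rz rw; rewrite [e]splitr; apply: (@ball_triangle _ _ r).
      by apply: ball_sym; exact: le_ball (ltW ne) _ rz.
    exact: le_ball (ltW ne) _ rw.
  by split; [exact: tri xp pa|exact: tri yq qb].
apply: countable_bigcupT_measurable => [//|i].
rewrite /F; case: ifPn => _; last exact: measurable0.
by apply: measurableX; exact: measurable_ball.
Qed.

Definition lebesgue_on (R : realType) (Omega : bounded_convex_domain R)
    : {measure set (mplane R) -> \bar R} :=
  mrestr (lebesgue_measure \x lebesgue_measure)%E
    (open_measurable_plane (@region_open R Omega)).

(* Elements of L2 Omega are square-integrable functions, not classes of such
   functions: equality in L^2(Omega) is [L2eq], and every notion below depends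
   on functions only up to [L2eq]. *)
Definition L2 (R : realType) (Omega : bounded_convex_domain R) :=
  LfunType (lebesgue_on Omega) (lee1n 2).

Section L2_structure.
Context (R : realType) (Omega : bounded_convex_domain R).
Implicit Types u v : L2 Omega.

Definition L2eq u v : Prop := u = v %[ae lebesgue_on Omega].

Definition inner u v : R := \int[lebesgue_on Omega]_z (u z * v z).

Definition eL2norm (h : mplane R -> R) : \bar R :=
  ('N[lebesgue_on Omega]_2%:E[EFin \o h])%E.

Definition L2norm u : R := fine (eL2norm u).

End L2_structure.

Section operators.
Context (R : realType) (Omega : bounded_convex_domain R).

(* A (partially defined) linear operator of L^2(Omega) is given by its graph. *)
Definition operator := L2 Omega -> L2 Omega -> Prop.

Implicit Types A S : operator.

Definition domain A (u : L2 Omega) : Prop := exists g, A u g.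

(* The value A u, unique up to [L2eq] for the operators below when [u] is in
   the domain; 0 outside the domain. *)
Definition app A (u : L2 Omega) : L2 Omega := xget 0 [set g | A u g].

Definition densely_defined A : Prop :=
  forall (u : L2 Omega) (e : R), 0 < e ->
    exists2 v, domain A v & L2norm (u - v) < e.

Definition adjoint A : operator :=
  fun v h => forall u g, A u g -> inner g v = inner u h.

(* A = A^*; since an adjoint graph is a closed linear subspace and A is densely
   defined, linearity, closedness and single-valuedness up to [L2eq] follow. *)
Definition self_adjoint A : Prop :=
  densely_defined A /\ forall u g, A u g <-> adjoint A u g.

Definition nonnegative A : Prop := forall u g, A u g -> 0 <= inner g u.

(* S = A^(1/2): for a nonnegative self-adjoint A, there is exactly one such S,
   up to [L2eq], and it is the square root given by the spectral calculus. *)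
Definition is_square_root A S : Prop :=
  [/\ self_adjoint S, nonnegative S &
      forall u g, A u g <-> exists2 h, S u h & S h g].

End operators.

Section dirichlet_laplacian.
Context (R : realType) (Omega : bounded_convex_domain R).

Definition axis (i : bool) : R * R := if i then (0, 1) else (1, 0).

Definition pderiv (i : bool) (phi : R * R -> R) : R * R -> R :=
  'D_(axis i) phi.

Definition smooth (phi : R * R -> R) : Prop :=
  forall s : seq bool,
    continuous (foldr pderiv phi s) /\
    forall i z, derivable (foldr pderiv phi s) z (axis i).

Definition test_function (phi : R * R -> R) : Prop :=
  smooth phi /\
  exists K : set (R * R),
    [/\ compact K, K `<=` Omega & forall z, ~ K z -> phi z = 0].

Definition weak_partial (i : bool) (u g : L2 Omega) : Prop :=
  forall phi, test_function phi ->
    \int[lebesgue_on Omega]_z (u z * pderiv i phi z) =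
    - \int[lebesgue_on Omega]_z (g z * phi z).

(* H^1_0(Omega), the closure of C_c^oo(Omega) in H^1(Omega) *)
Definition H10 (u : L2 Omega) : Prop :=
  exists phi : nat -> R * R -> R,
    [/\ forall j, test_function (phi j),
        eL2norm Omega (fun z => phi j z - u z) @[j --> \oo] --> 0%E &
        forall i, exists2 g : L2 Omega, weak_partial i u g &
          eL2norm Omega (fun z => pderiv i (phi j) z - g z) @[j --> \oo] --> 0%E].

(* partial weak derivative, 0 if there is none in L^2(Omega) *)
Definition wderiv (i : bool) (u : L2 Omega) : L2 Omega :=
  xget 0 [set g | weak_partial i u g].

(* a(u, v) = (grad u, grad v) *)
Definition dirichlet_form (u v : L2 Omega) : R :=
  inner (wderiv false u) (wderiv false v) +
  inner (wderiv true u) (wderiv true v).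

(* the operator associated with the form a on H^1_0(Omega) *)
Definition dirichlet_laplacian : operator Omega :=
  fun u g => H10 u /\ forall v, H10 v -> dirichlet_form u v = inner g v.

End dirichlet_laplacian.

(* C^1([0, T]): continuous on [0, T], differentiable in the interior, with a
   derivative that extends continuously to [0, T]; values of [a] outside
   [0, T] are irrelevant. *)
Definition C1_on (R : realType) (T : R) (a : R -> R) : Prop :=
  derivable_oo_LRcontinuous a 0 T /\
  exists2 b : R -> R, {within `[0, T], continuous b} &
    {in `]0, T[, derive1 a =1 b}.

Section scheme.
Context (R : realType) (Omega : bounded_convex_domain R).
Context (sqrtL : operator Omega) (T : R) (alpha beta : R -> R).
Context (u0 v0 w0 : L2 Omega).

Local Notation L := (@dirichlet_laplacian R Omega).

Definition continuous_source (f : R -> L2 Omega) : Prop :=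
  forall t, t \in `[0, T] ->
    L2norm (f s - f t) @[s --> within `[0, T] (nbhs t)] --> (0 : R).

(* w0 = f(0) + q0 Delta u0, with Delta u0 = - L u0 *)
Definition initial_acceleration (f : R -> L2 Omega) : Prop :=
  let q0 := alpha 0 + beta 0 * dirichlet_form u0 u0 in
  L2eq w0 (f 0 - q0 *: app L u0).

(* the data f compatible with w0 and with max_[0, T] |f| = Fmax *)
Definition admissible_source (Fmax : R) (f : R -> L2 Omega) : Prop :=
  [/\ continuous_source f,
      sup [set L2norm (f t) | t in `[0, T]] = Fmax &
      initial_acceleration f].

Definition first_step (tau : R) : L2 Omega :=
  u0 + tau *: v0 + (tau ^+ 2 / 2) *: w0.

Definition half_energy (u : L2 Omega) : R := 2^-1 * L2norm (app sqrtL u) ^+ 2.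

Definition initial_energy (tau : R) : R :=
  let u1 := first_step tau in
  let V0 := half_energy u0 in
  let V1 := half_energy u1 in
  2^-1 * L2norm (tau^-1 *: (u1 - u0)) ^+ 2 +
  alpha 0 / 2 * (V0 + V1) + beta 0 / 2 * (V0 ^+ 2 + V1 ^+ 2).

(* only the terms u 0, ..., u n of the sequence are constrained *)
Definition scheme_solution (f : R -> L2 Omega) (n : nat)
    (u : nat -> L2 Omega) : Prop :=
  let tau := T / n%:R in
  [/\ forall k, (k <= n)%N -> domain L (u k),
      L2eq (u 0%N) u0,
      L2eq (u 1%N) (first_step tau) &
      forall k, (1 <= k < n)%N ->
        let t := k%:R * tau in
        L2eq
          ((tau ^+ 2)^-1 *: (u k.+1 - 2 *: u k + u k.-1) +
           (2^-1 * (alpha t + beta t / 2 *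
              (L2norm (app sqrtL (u k.+1)) ^+ 2 +
               L2norm (app sqrtL (u k.-1)) ^+ 2))) *:
           (app L (u k.+1) + app L (u k.-1)))
          (f t)].

End scheme.

(* Main.v *)
Require Import Defs.
From HB Require Import structures.
From mathcomp Require Import all_boot all_order all_algebra.
From mathcomp Require Import all_classical all_reals all_analysis.
From mathcomp Require Import ring lra.

Set Implicit Arguments.
Unset Strict Implicit.
Unset Printing Implicit Defensive.
Import Order.TTheory GRing.Theory Num.Theory.
Import numFieldNormedType.Exports.

Local Open Scope classical_set_scope.
Local Open Scope ring_scope.

(** The scheme is tested against the central difference u_(k+1) - u_(k-1).
Write d_k = (u_k - u_(k-1)) / tau and V_k = |L^(1/2) u_k|^2 / 2.  The second
difference gives |d_(k+1)|^2 - |d_k|^2, and the operator term gives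
q (V_(k+1) - V_(k-1)) with q = alpha_k + beta_k (V_(k+1) + V_(k-1)), so that the
nonlinear part is beta_k (V_(k+1)^2 - V_(k-1)^2): everything telescopes into the
energy
  E_(k+1) = |d_(k+1)|^2 / 2 + alpha_k (V_k + V_(k+1)) / 2
            + beta_k (V_k^2 + V_(k+1)^2) / 2,
up to the work of the source and the variation of the coefficients
([scheme_energy_identity]).

A positive C^1 coefficient grows at most by the factor 1 + c tau over one time
step ([C1_coefficient]), hence so does the energy when only the coefficients
change ([energy_growth]).  Altogether
  E_(k+1) <= (1 + c tau) E_k + tau F (|d_(k+1)| + |d_k|) / 2.
Since |d| is controlled by the square root e of the energy, dividing by
e_(k+1) + e_k turns this implicit quadratic recursion into the explicit linear one
e_(k+1) <= (1 + c tau) e_k + tau F ([sqrt_step]); this is what makes the bound hold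
for every n, without a smallness condition on tau.  The discrete Gronwall lemma
then bounds e_k by exp(cT) (e_1 + T F), hence |d_k|, and V_k by the positive lower
bound of alpha ([energy_ge]).

It remains to bound E_1 uniformly in tau, which is where L^(1/2) u0, L^(1/2) v0 and
L^(1/2) w0 enter: L^(1/2) is linear, so that |L^(1/2) u_1| is at most
|L^(1/2) u0| + T |L^(1/2) v0| + T^2 |L^(1/2) w0| / 2 ([initial_energy_bounded]).

Self-adjointness of L^(1/2) provides its linearity, the uniqueness of its values and,
as L is the square of L^(1/2), (L u, v) = (L^(1/2) u, L^(1/2) v).  Since elements of L^2 are functions and not
classes, equality in L^2 is handled as equality of the functionals
[inner u = inner v], which rewrites under inner products and norms. *)

(** * The inner product of L^2 *)

Section inner_product.
Context (R : realType) (Omega : bounded_convex_domain R).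
Implicit Types u v w : L2 Omega.

Lemma inner_integrable u v :
  (lebesgue_on Omega).-integrable setT (EFin \o (fun z => u z * v z)).
Proof. by apply/Lfun1_integrable; apply: Lfun2_mul_Lfun1; exact: LfunP. Qed.

Lemma innerC u v : inner u v = inner v u.
Proof. by rewrite /inner; congr Rintegral; apply/funext => z; rewrite mulrC. Qed.

Lemma innerDl u v w : inner (u + v) w = inner u w + inner v w.
Proof.
rewrite /inner -RintegralD//; try exact: inner_integrable.
by congr Rintegral; apply/funext => z /=; rewrite mulrDl.
Qed.

Lemma innerZl a u w : inner (a *: u) w = a * inner u w.
Proof.
rewrite /inner -RintegralZl//; last exact: inner_integrable.
by congr Rintegral; apply/funext => z /=; rewrite mulrA.
Qed.

Lemma innerNl u w : inner (- u) w = - inner u w.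
Proof. by rewrite -scaleN1r innerZl mulN1r. Qed.

Lemma innerBl u v w : inner (u - v) w = inner u w - inner v w.
Proof. by rewrite innerDl innerNl. Qed.

Lemma innerDr u v w : inner w (u + v) = inner w u + inner w v.
Proof. by rewrite innerC innerDl !(innerC w). Qed.

Lemma innerZr a u w : inner w (a *: u) = a * inner w u.
Proof. by rewrite innerC innerZl innerC. Qed.

Lemma innerBr u v w : inner w (u - v) = inner w u - inner w v.
Proof. by rewrite innerC innerBl !(innerC w). Qed.

Lemma inner_ge0 u : 0 <= inner u u.
Proof. by apply: Rintegral_ge0 => z _; rewrite -expr2 sqr_ge0. Qed.

Lemma L2normE u : L2norm u = Num.sqrt (inner u u).
Proof.
rewrite /L2norm /eL2norm unlock.
under eq_integral do rewrite /= powR_mulrn// real_normK ?num_real// expr2.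
rewrite -[X in fine (X `^ _)%E]fineK; last first.
  exact: integrable_fin_num (inner_integrable u u).
by rewrite poweR_EFin/= powR12_sqrt// inner_ge0.
Qed.

Lemma L2norm_ge0 u : 0 <= L2norm u.
Proof. by rewrite L2normE sqrtr_ge0. Qed.

Lemma L2norm_sqr u : L2norm u ^+ 2 = inner u u.
Proof. by rewrite L2normE sqr_sqrtr// inner_ge0. Qed.

Lemma L2normZ a u : L2norm (a *: u) = `|a| * L2norm u.
Proof.
by rewrite !L2normE innerZl innerZr mulrA -expr2 sqrtrM ?sqr_ge0// sqrtr_sqr.
Qed.

Lemma L2normB_sym u v : L2norm (u - v) = L2norm (v - u).
Proof. by rewrite -opprB -scaleN1r L2normZ normrN1 mul1r. Qed.

(** Cauchy-Schwarz, from the squared norm of |v|^2 u - (u, v) v. *)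
Lemma inner_le u v : inner u v <= L2norm u * L2norm v.
Proof.
have pu := L2norm_ge0 u; have pv := L2norm_ge0 v.
have H (t : R) : 0 <= L2norm u ^+ 2 - 2 * t * inner u v + t ^+ 2 * L2norm v ^+ 2.
  have := inner_ge0 (u - t *: v).
  rewrite !innerBl !innerBr !innerZl !innerZr (innerC v u) !L2norm_sqr; lra.
(* If |v| = 0, a positive inner product would make H fail for large t. *)
case: (eqVneq (L2norm v) 0) => [v0|v0].
  rewrite v0 mulr0 leNgt; apply/negP => i0.
  have := H ((L2norm u ^+ 2 + 1) / (2 * inner u v)).
  rewrite v0 expr0n/= mulr0 addr0.
  have -> : 2 * ((L2norm u ^+ 2 + 1) / (2 * inner u v)) * inner u v
            = L2norm u ^+ 2 + 1 by field; lra.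
  lra.
have {v0 pv}v0 : 0 < L2norm v by rewrite lt_neqAle eq_sym v0.
have := inner_ge0 (L2norm v ^+ 2 *: u - inner u v *: v).
rewrite !innerBl !innerBr !innerZl !innerZr (innerC v u) -!L2norm_sqr.
rewrite [X in 0 <= X](_ : _ =
  L2norm v ^+ 2 * ((L2norm u * L2norm v) ^+ 2 - inner u v ^+ 2)); last by ring.
rewrite pmulr_rge0 ?exprn_gt0// subr_ge0 => {}H.
rewrite (le_trans (ler_norm _))// -(@ler_pXn2r _ 2)// ?nnegrE ?mulr_ge0//.
  by rewrite real_normK// num_real.
exact: ltW.
Qed.

Lemma L2normD u v : L2norm (u + v) <= L2norm u + L2norm v.
Proof.
rewrite -(@ler_pXn2r _ 2)// ?nnegrE ?addr_ge0 ?L2norm_ge0//.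
rewrite L2norm_sqr innerDl !innerDr (innerC v u) sqrrD !L2norm_sqr.
have := inner_le u v; lra.
Qed.

Lemma L2eq_inner u v : L2eq u v -> inner u = inner v.
Proof.
move=> uv; apply/funext => w; rewrite /inner /Rintegral; congr fine.
apply: ae_eq_integral => //; try exact: (measurable_int _ (inner_integrable _ _)).
by case: uv => N [mN N0 sub]; exists N; split => // z /= zN; apply: sub => /= uvz; apply: zN => ? /=; rewrite uvz.
Qed.

Lemma eq_inner_L2norm u v : inner u = inner v -> L2norm u = L2norm v.
Proof. by move=> uv; rewrite !L2normE uv innerC uv. Qed.
End inner_product.

(** * Self-adjoint operators and square roots *)

Section self_adjoint_operators.
Context (R : realType) (Omega : bounded_convex_domain R).
Implicit Types (u v g h : L2 Omega) (A S : operator Omega).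

Lemma app_graph A u : domain A u -> A u (app A u).
Proof. by move=> Au; rewrite /app; exact: xgetPex. Qed.

Lemma self_adjoint_symmetric S u g v h : self_adjoint S ->
  S u g -> S v h -> inner g v = inner u h.
Proof. by move=> [_ SE] Sug /SE; exact. Qed.

(** Two values of S at u differ by a vector orthogonal to the domain, which is
dense. *)
Lemma self_adjoint_unique S u g h : self_adjoint S ->
  S u g -> S u h -> inner g = inner h.
Proof.
move=> saS Sug Suh; have [dS _] := saS.
have orth v : domain S v -> inner v (g - h) = 0.
  move=> [k Svk]; apply/eqP; rewrite innerBr subr_eq0; apply/eqP.
  by rewrite -(self_adjoint_symmetric saS Svk Sug) (self_adjoint_symmetric saS Svk Suh).
have gh0 : L2norm (g - h) = 0.
  apply/eqP; rewrite eq_le L2norm_ge0 andbT leNgt; apply/negP => gh0.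
  have [v /orth vgh] := dS (g - h) _ gh0.
  apply/negP; rewrite -leNgt -(ler_pM2r gh0) -expr2 L2norm_sqr.
  rewrite -[X in X <= _]subr0 -[X in _ - X]vgh -innerBl; exact: inner_le.
apply/funext => w; apply/eqP; rewrite -subr_eq0 -innerBl eq_le.
have := inner_le (g - h) w; have := inner_le (g - h) (- w).
by rewrite gh0 !mul0r (innerC _ (- w)) innerNl (innerC w) oppr_le0 => -> ->.
Qed.

(** The graph of S, being the graph of an adjoint, is described by inner products
only; this gives the next two lemmas. *)
Lemma self_adjoint_congr S u v g : self_adjoint S ->
  inner u = inner v -> S u g -> S v g.
Proof.
move=> [_ SE] uv /SE Sug; apply/SE => w h Swh.
by rewrite innerC -uv innerC; exact: Sug.
Qed.

Lemma self_adjoint_linear S a u g v h : self_adjoint S ->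
  S u g -> S v h -> S (u + a *: v) (g + a *: h).
Proof.
move=> [_ SE] /SE Sug /SE Svh; apply/SE => w k Swk.
by rewrite !innerDr !innerZr (Sug _ _ Swk) (Svh _ _ Swk).
Qed.

Lemma self_adjoint_L2norm_app S u v g : self_adjoint S ->
  inner u = inner v -> S u g -> L2norm (app S v) = L2norm g.
Proof.
move=> saS uv Sug; have Svg := self_adjoint_congr saS uv Sug.
apply: eq_inner_L2norm; apply: (self_adjoint_unique saS _ Svg).
by apply: app_graph; exists g.
Qed.

Section square_root.
Context A S (AS : is_square_root A S).

Lemma square_root_self_adjoint : self_adjoint S.
Proof. by case: AS. Qed.

Lemma domain_square_root u : domain A u -> domain S u.
Proof. by case: AS => _ _ E [g /E[h Suh _]]; exists h. Qed.

(** Factor the value of A at u as S h with h a value of S at u, and move the outer S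
to v. *)
Lemma inner_app_square_root u v : domain A u -> domain S v ->
  inner (app A u) v = inner (app S u) (app S v).
Proof.
move=> /app_graph Au /app_graph Sv; have saS := square_root_self_adjoint.
case: AS => _ _ /(_ u (app A u))[/(_ Au)[h Suh Shg] _].
rewrite (self_adjoint_symmetric saS Shg Sv) (self_adjoint_unique saS Suh (h := app S u))//.
by apply: app_graph; exists h.
Qed.

End square_root.

Lemma half_energy_congr S u v : self_adjoint S -> domain S u ->
  inner u = inner v -> half_energy S v = half_energy S u.
Proof.
move=> saS /app_graph Su uv; rewrite /half_energy.
by rewrite (self_adjoint_L2norm_app saS uv Su).
Qed.

End self_adjoint_operators.

(** * The data: coefficients and source *)

(** By the mean value theorem [a t - a s <= B * (t - s)], where [B] bounds the
derivative, and [1 <= a s / m] makes the increment proportional to [a s]. *)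
Lemma C1_coefficient (R : realType) (T : R) (a : R -> R) : 0 < T -> C1_on T a ->
    0 < inf (a @` `[0, T]) ->
  exists m c : R, [/\ 0 < m, 0 <= c,
    forall t : R, 0 <= t <= T -> m <= a t &
    forall s t : R, 0 <= s -> s <= t -> t <= T -> a t <= (1 + c * (t - s)) * a s].
Proof.
move=> T0 [aT [b cb ab]] m0; set m := inf _ in m0.
have ca := derivable_oo_LRcontinuous_within aT.
have ma t : 0 <= t <= T -> m <= a t.
  move=> tT; apply: ge_inf; last by exists t => //=; rewrite in_itv.
  have [s _ smin] := EVT_min (ltW T0) ca.
  by exists (a s) => _ [r /= rT <-]; apply: smin.
have [x _ xmax] := EVT_max (ltW T0) cb; pose B := Num.max 0 (b x).
have B0 : 0 <= B by rewrite le_max lexx.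
exists m, (B / m); split => //; first by rewrite divr_ge0// ltW.
move=> s t s0 st tT.
have as_ : a t - a s <= B * (t - s).
  have [c|| c sct ->] := @MVT_segment _ a b s t st.
  - rewrite in_itv/= => /andP[sc ct].
    have cT : c \in `]0, T[.
      by rewrite in_itv/= (le_lt_trans s0 sc) (lt_le_trans ct tT).
    by case: aT => /(_ c cT) dac _ _; split => //; rewrite -ab// derive1E.
  - move: ca; apply: continuous_subspaceW => y /=; rewrite !in_itv/= => /andP[sy yt].
    by rewrite (le_trans s0 sy) (le_trans yt tT).
  - move: sct; rewrite in_itv/= => /andP[sc ct]; apply: ler_wpM2r; first by rewrite subr_ge0.
    rewrite le_max; apply/orP; right; apply: xmax.
    by rewrite in_itv/= (le_trans s0 sc) (le_trans ct tT).
have mas : m <= a s by rewrite ma// s0 (le_trans st tT).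
rewrite mulrDl mul1r -lerBlDl (le_trans as_)//.
have -> : B / m * (t - s) * a s = B * (t - s) * (a s / m) by ring.
rewrite ler_peMr ?mulr_ge0 ?subr_ge0// ler_pdivlMr// mul1r//.
Qed.

(** The norm is continuous along [f] by the triangle inequality, hence bounded on the
compact interval, so that the supremum is a genuine upper bound. *)
Lemma L2norm_le_sup (R : realType) (Omega : bounded_convex_domain R) (T : R)
    (f : R -> L2 Omega) (t : R) : continuous_source T f -> 0 <= t <= T ->
  L2norm (f t) <= sup [set L2norm (f s) | s in `[0, T]].
Proof.
move=> cf tT; apply: ub_le_sup; last by exists t => //=; rewrite in_itv.
have cN : {within `[0, T], continuous (fun s => L2norm (f s))}.
  apply/subspace_continuousP => x /= xT.
  apply/cvgrPdist_le => e e0; have /cvgrPdist_le/(_ e e0) := cf x xT.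
  apply: filterS => y; rewrite sub0r normrN ger0_norm ?L2norm_ge0// => fye.
  apply: le_trans fye; rewrite ler_norml.
  have := L2normD (f y - f x) (f x); have := L2normD (f x - f y) (f y).
  rewrite /from_subspace !subrK (L2normB_sym (f x)) => fx fy.
  by apply/andP; split; lra.
have T0 : 0 <= T by case/andP: tT => t0; apply: le_trans t0.
have [x _ xmax] := EVT_max T0 cN.
by exists (L2norm (f x)) => _ [s /= sT <-]; exact: xmax.
Qed.

(** * The energy *)

(** The discrete energy is a function of numbers rather than of an index because one
time step changes the coefficients [a], [b] and the quantities [d], [V], [V']
separately: [d] is the norm of a difference quotient, [V] and [V'] are half the
squared norms of L^(1/2) u at its two ends. *)
Definition energy (R : realType) (a b d V V' : R) : R :=
  2^-1 * d ^+ 2 + a / 2 * (V + V') + b / 2 * (V ^+ 2 + V' ^+ 2).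

Lemma energy_ge (R : realType) (a b d V V' : R) : 0 <= a -> 0 <= b -> 0 <= V -> 0 <= V' ->
  [/\ 0 <= energy a b d V V', d ^+ 2 <= 2 * energy a b d V V' &
   a * V' <= 2 * energy a b d V V'].
Proof.
move=> a0 b0 V0 V'0; rewrite /energy.
have := mulr_ge0 a0 V0; have := mulr_ge0 a0 V'0.
have := mulr_ge0 b0 (sqr_ge0 V); have := mulr_ge0 b0 (sqr_ge0 V'); have := sqr_ge0 d.
by split; lra.
Qed.

Lemma energy_growth (R : realType) (a b a' b' k d V V' : R) : 0 <= k ->
  0 <= V -> 0 <= V' -> a' <= (1 + k) * a -> b' <= (1 + k) * b ->
  energy a' b' d V V' <= (1 + k) * energy a b d V V'.
Proof.
move=> k0 V0 V'0 aa bb; rewrite /energy.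
have := ler_wpM2r (addr_ge0 V0 V'0) aa.
have := ler_wpM2r (addr_ge0 (sqr_ge0 V) (sqr_ge0 V')) bb.
have := mulr_ge0 k0 (sqr_ge0 d); lra.
Qed.

Lemma energy_le (R : realType) (a b d d' V V' V'' : R) : 0 <= a -> 0 <= b ->
  0 <= d -> 0 <= V' -> d <= d' -> V' <= V'' ->
  energy a b d V V' <= energy a b d' V V''.
Proof.
move=> a0 b0 d0 V'0 dd VV; have d'0 := le_trans d0 dd; have V''0 := le_trans V'0 VV.
apply: lerD; first apply: lerD.
- by rewrite ler_wpM2l// lerXn2r.
- by rewrite ler_wpM2l ?divr_ge0// lerD2l.
- by rewrite ler_wpM2l ?divr_ge0// lerD2l lerXn2r.
Qed.

(** The result of pairing one step of the scheme with [p - q], for [p], [c], [q] the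
next, current and previous terms.  Both energies carry the coefficients of the
current time. *)
Lemma scheme_energy_identity (R : realType) (Omega : bounded_convex_domain R)
    (A S : operator Omega) (AS : is_square_root A S)
    (tau a b : R) (p c q f : L2 Omega) : tau != 0 ->
    domain A p -> domain A q ->
    L2eq
      ((tau ^+ 2)^-1 *: (p - 2 *: c + q) +
       (2^-1 * (a + b / 2 * (L2norm (app S p) ^+ 2 + L2norm (app S q) ^+ 2))) *:
       (app A p + app A q)) f ->
  energy a b (L2norm (tau^-1 *: (p - c))) (half_energy S c) (half_energy S p) -
  energy a b (L2norm (tau^-1 *: (c - q))) (half_energy S q) (half_energy S c) =
  tau / 2 * inner f (tau^-1 *: (p - c) + tau^-1 *: (c - q)).
Proof.
move=> t0 Ap Aq /L2eq_inner <-.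
have Sp := domain_square_root AS Ap; have Sq := domain_square_root AS Aq.
have -> : tau^-1 *: (p - c) + tau^-1 *: (c - q) = tau^-1 *: (p - q).
  by rewrite -scalerDr addrA subrK.
rewrite /energy /half_energy !L2norm_sqr !(innerBr, innerZr, innerDl, innerNl, innerZl).
rewrite !(inner_app_square_root AS)// (innerC c p) (innerC q p) (innerC q c).
rewrite (innerC (app S q) (app S p)).
by field.
Qed.

(** * From the energy recursion to a bound *)

(** The hypothesis reads (y - x) (x + y) <= k x^2 + m (x + y), and
[x ^+ 2 <= x * (x + y)]: divide by [x + y]. *)
Lemma sqrt_step (R : realType) (x y k m : R) : 0 <= x -> 0 <= y -> 0 <= k -> 0 <= m ->
  y ^+ 2 <= (1 + k) * x ^+ 2 + m * (x + y) -> y <= (1 + k) * x + m.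
Proof.
move=> x0 y0 k0 m0 H.
case: (eqVneq (x + y) 0) => [xy|xy].
  have -> : y = 0 by lra.
  by rewrite addr_ge0// mulr_ge0// addr_ge0.
have {}xy : 0 < x + y by rewrite lt_neqAle eq_sym xy addr_ge0.
suff : (y - x) * (x + y) <= (k * x + m) * (x + y) by rewrite ler_pM2r//; lra.
have : 0 <= k * (x * y) by rewrite !mulr_ge0.
lra.
Qed.

Lemma discrete_gronwall (R : realType) (n : nat) (k m : R) (e : nat -> R) :
  0 <= k -> 0 <= m -> 0 <= e 0%N ->
  (forall j, (j < n)%N -> e j.+1 <= (1 + k) * e j + m) ->
  forall j, (j <= n)%N -> e j <= expR (k *+ j) * (e 0%N + m *+ j).
Proof.
move=> k0 m0 e0 H; elim=> [_|j IH jn]; first by rewrite expR0 mul1r addr0.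
rewrite (le_trans (H _ jn))//.
have B0 : 0 <= expR (k *+ j) * (e 0%N + m *+ j).
  by rewrite mulr_ge0 ?expR_ge0// addr_ge0// mulrn_wge0.
rewrite [leRHS](_ : _ = expR k * (expR (k *+ j) * (e 0%N + m *+ j)) +
  expR (k *+ j.+1) * m); last by rewrite !mulrSr expRD; ring.
apply: lerD; last by rewrite ler_peMl// -expR0 ler_expR mulrn_wge0.
apply: (@le_trans _ _ ((1 + k) * (expR (k *+ j) * (e 0%N + m *+ j)))).
  by rewrite ler_wpM2l ?addr_ge0// IH// ltnW.
by rewrite ler_wpM2r// expR_ge1Dx.
Qed.

(** The weaker [d j <= 2 * sqrt (E j)] absorbs the factor 1/2 of the source term and
avoids a square root of 2 in the constants. *)
Lemma energy_recursion_bound (R : realType) (n : nat) (k m : R) (d E : nat -> R) :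
  0 <= k -> 0 <= m ->
  (forall j, (j <= n)%N -> 0 <= E j /\ d j ^+ 2 <= 2 * E j) ->
  (forall j, (j < n)%N -> E j.+1 <= (1 + k) * E j + m / 2 * (d j.+1 + d j)) ->
  forall j, (j <= n)%N ->
    Num.sqrt (E j) <= expR (k *+ j) * (Num.sqrt (E 0%N) + m *+ j).
Proof.
move=> k0 m0 EP rec; apply: discrete_gronwall; rewrite ?sqrtr_ge0// => j jn.
have d_le i : (i <= n)%N -> d i <= 2 * Num.sqrt (E i).
  move=> /EP[Ei dEi].
  rewrite (le_trans (ler_norm _))// -(@ler_pXn2r _ 2)// ?nnegrE ?mulr_ge0 ?sqrtr_ge0//.
  by rewrite real_normK ?num_real// exprMn sqr_sqrtr//; lra.
have [Ej _] := EP j (ltnW jn); have [Ej1 _] := EP j.+1 jn.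
apply: sqrt_step; rewrite ?sqrtr_ge0// !sqr_sqrtr// (le_trans (rec _ jn))// lerD2l.
rewrite -mulrA ler_wpM2l//; have := d_le j (ltnW jn); have := d_le j.+1 jn; lra.
Qed.

(** * The initial energy *)

Lemma first_step_graph (R : realType) (Omega : bounded_convex_domain R)
    (S : operator Omega) (u0 v0 w0 : L2 Omega) (tau : R) : self_adjoint S ->
    domain S u0 -> domain S v0 -> domain S w0 ->
  S (first_step u0 v0 w0 tau)
    (first_step (app S u0) (app S v0) (app S w0) tau).
Proof.
move=> saS /app_graph u0S /app_graph v0S /app_graph w0S.
by do 2?apply: self_adjoint_linear.
Qed.

(** The difference quotient is v0 + (tau / 2) w0, and L^(1/2) u_1 is the same
polynomial in tau as u_1; the triangle inequality bounds both norms by expressions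
that increase with tau, and tau is at most T. *)
Lemma initial_energy_bounded (R : realType) (Omega : bounded_convex_domain R)
    (S : operator Omega) (T : R) (alpha beta : R -> R) (u0 v0 w0 : L2 Omega) :
    self_adjoint S -> domain S u0 -> domain S v0 -> domain S w0 ->
    0 <= alpha 0 -> 0 <= beta 0 ->
  exists C : R, forall tau : R, 0 < tau <= T ->
    initial_energy S alpha beta u0 v0 w0 tau <= C.
Proof.
move=> saS u0S v0S w0S a0 b0.
pose D := L2norm v0 + T / 2 * L2norm w0.
pose W := L2norm (app S u0) + T * L2norm (app S v0) + T ^+ 2 / 2 * L2norm (app S w0).
exists (energy (alpha 0) (beta 0) D (half_energy S u0) (2^-1 * W ^+ 2)) => tau /andP[t0 tT].
have T0 : 0 <= T by rewrite (le_trans (ltW t0)).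
rewrite /initial_energy -/(energy _ _ _ _ _); apply: energy_le => //.
- exact: L2norm_ge0.
- by rewrite /half_energy mulr_ge0// sqr_ge0.
- have -> : tau^-1 *: (first_step u0 v0 w0 tau - u0) = v0 + (tau / 2) *: w0.
    rewrite /first_step -[u0 + _ + _]addrA [u0 + _]addrC addrK scalerDr !scalerA.
    rewrite mulVf ?gt_eqF// scale1r.
    by congr (_ + _ *: _); field; rewrite gt_eqF.
  rewrite (le_trans (L2normD _ _))// lerD2l L2normZ ger0_norm ?divr_ge0 ?(ltW t0)//.
  by rewrite ler_wpM2r ?L2norm_ge0// ler_wpM2r.
- rewrite /half_energy ler_wpM2l// (self_adjoint_L2norm_app saS erefl
    (first_step_graph tau saS u0S v0S w0S)).
  rewrite lerXn2r ?nnegrE ?L2norm_ge0//.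
    by rewrite !addr_ge0 ?mulr_ge0 ?divr_ge0 ?sqr_ge0 ?L2norm_ge0.
  rewrite (le_trans (L2normD _ _))// lerD//.
    rewrite (le_trans (L2normD _ _))// lerD2l L2normZ gtr0_norm//.
    by rewrite ler_wpM2r ?L2norm_ge0.
  rewrite L2normZ ger0_norm ?divr_ge0 ?sqr_ge0// ler_wpM2r ?L2norm_ge0// ler_wpM2r//.
  by rewrite lerXn2r ?nnegrE// ltW.
Qed.

(** * The a priori estimate *)

(** Indices are shifted by one: [E k] is the energy between the terms [k] and [k.+1],
with the coefficients of the earlier one. *)
Lemma scheme_energy_bound (R : realType) (Omega : bounded_convex_domain R)
    (A S : operator Omega) (AS : is_square_root A S)
    (n : nat) (tau c F : R) (a b : nat -> R) (f u : nat -> L2 Omega) :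
    0 < tau -> 0 <= c ->
    (forall k, (k <= n)%N -> 0 <= a k /\ 0 <= b k) ->
    (forall k, (k < n)%N ->
       a k.+1 <= (1 + c * tau) * a k /\ b k.+1 <= (1 + c * tau) * b k) ->
    (forall k, (k <= n)%N -> L2norm (f k) <= F) ->
    (forall k, (k <= n.+1)%N -> domain A (u k)) ->
    (forall k, (k < n)%N -> L2eq
       ((tau ^+ 2)^-1 *: (u k.+2 - 2 *: u k.+1 + u k) +
        (2^-1 * (a k.+1 + b k.+1 / 2 *
           (L2norm (app S (u k.+2)) ^+ 2 + L2norm (app S (u k)) ^+ 2))) *:
        (app A (u k.+2) + app A (u k))) (f k.+1)) ->
  let E k := energy (a k) (b k) (L2norm (tau^-1 *: (u k.+1 - u k)))
               (half_energy S (u k)) (half_energy S (u k.+1)) in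
  forall k, (k <= n)%N ->
    Num.sqrt (E k) <=
      expR (c * tau *+ k) * (Num.sqrt (E 0%N) + tau * F *+ k).
Proof.
move=> t0 c0 ab0 abS fF uA eqn E.
have F0 : 0 <= F by apply: le_trans (fF 0%N isT); exact: L2norm_ge0.
have V0 v : 0 <= half_energy S v by rewrite mulr_ge0// sqr_ge0.
pose d k := L2norm (tau^-1 *: (u k.+1 - u k)).
have EP k : (k <= n)%N -> 0 <= E k /\ d k ^+ 2 <= 2 * E k.
  by move=> /ab0[ak bk]; have [] := energy_ge (d k) ak bk (V0 (u k)) (V0 (u k.+1)).
apply: (energy_recursion_bound (d := d)) => //; try by rewrite mulr_ge0// ltW.
move=> k kn.
have := scheme_energy_identity AS (lt0r_neq0 t0) (uA k.+2 kn) (uA k (leqW (ltnW kn))) (eqn k kn).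
have [ak bk] := abS k kn.
have := energy_growth (d k) (mulr_ge0 c0 (ltW t0)) (V0 (u k)) (V0 (u k.+1)) ak bk.
rewrite -/(E k.+1) -/(d k) -/(E k) => grow step.
have work : inner (f k.+1) (tau^-1 *: (u k.+2 - u k.+1) + tau^-1 *: (u k.+1 - u k))
    <= F * (d k.+1 + d k).
  apply: le_trans (inner_le _ _) _.
  by rewrite ler_pM ?L2norm_ge0 ?fF//; exact: L2normD.
have {}work := ler_wpM2l (ltW (divr_gt0 t0 (ltr0n _ 2))) work.
move: step; rewrite -/(d k.+1) -/(E k.+1) => step.
rewrite [_ * F / 2]mulrAC -mulrA; lra.
Qed.

Theorem lemma4p1 (R : realType) (Omega : bounded_convex_domain R)
    (sqrtL : operator Omega) (T : R) (alpha beta : R -> R)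
    (u0 v0 w0 : L2 Omega) (Fmax : R)
    (sqrtL_def : is_square_root (@dirichlet_laplacian R Omega) sqrtL)
    (T_gt0 : 0 < T)
    (alphaC1 : C1_on T alpha) (betaC1 : C1_on T beta)
    (alpha_min : 0 < inf (alpha @` `[0, T]))
    (beta_min : 0 < inf (beta @` `[0, T]))
    (u0L : domain (@dirichlet_laplacian R Omega) u0)
    (u0h : domain sqrtL u0) (v0h : domain sqrtL v0) (w0h : domain sqrtL w0) :
  (forall f : R -> L2 Omega,
     admissible_source T alpha beta u0 w0 Fmax f ->
     exists C : R, forall n : nat, (1 < n)%N ->
       initial_energy sqrtL alpha beta u0 v0 w0 (T / n%:R) <= C) /\
  exists M1 M2 : R,
    [/\ 0 < M1, 0 < M2 &
        forall f : R -> L2 Omega,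
          admissible_source T alpha beta u0 w0 Fmax f ->
        forall (n : nat) (u : nat -> L2 Omega), (1 < n)%N ->
          scheme_solution sqrtL T alpha beta u0 v0 w0 f n u ->
        forall k : nat, (1 <= k <= n)%N ->
          L2norm ((T / n%:R)^-1 *: (u k - u k.-1)) <= M1 /\
          L2norm (app sqrtL (u k)) <= M2].
Proof.
have saS := square_root_self_adjoint sqrtL_def.
have [m [ca [m0 ca0 alpha_ge alpha_growth]]] := C1_coefficient T_gt0 alphaC1 alpha_min.
have [mb [cb [mb0 cb0 beta_ge beta_growth]]] := C1_coefficient T_gt0 betaC1 beta_min.
have alpha_ge0 (t : R) : 0 <= t <= T -> 0 <= alpha t.
  by move=> /alpha_ge; apply: le_trans; exact: ltW.
have beta_ge0 (t : R) : 0 <= t <= T -> 0 <= beta t.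
  by move=> /beta_ge; apply: le_trans; exact: ltW.
have zT : 0 <= (0 : R) <= T by rewrite lexx ltW.
have [C E1C] := initial_energy_bounded T saS u0h v0h w0h (alpha_ge0 _ zT) (beta_ge0 _ zT).
have tauT n : (1 < n)%N -> 0 < T / n%:R <= T.
  move=> n1; have n0 : 0 < n%:R :> R by rewrite ltr0n ltnW.
  by rewrite divr_gt0//= ler_pdivrMr// ler_peMr ?ler1n ?(ltW T_gt0)// ltnW.
split; first by move=> f _; exists C => n /tauT; exact: E1C.
pose c := ca + cb.
(* K bounds the square root of the energy on the whole time interval. *)
have [K K0 KE] : exists2 K : R, 0 <= K & K = expR (c * T) * (Num.sqrt C + T * `|Fmax|).
  exists (expR (c * T) * (Num.sqrt C + T * `|Fmax|)) => //.
  by rewrite mulr_ge0 ?expR_ge0// addr_ge0 ?sqrtr_ge0// mulr_ge0// ltW.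
(* The bounds are 2 K and 2 K / sqrt m; adding 1 makes them positive. *)
exists (2 * K + 1), (2 * K / Num.sqrt m + 1); split.
- by rewrite ltr_wpDl// mulr_ge0.
- by rewrite ltr_wpDl// divr_ge0 ?sqrtr_ge0// mulr_ge0.
move=> f [fcont fmax _] [//|n] u n1 [].
set tau := T / n.+1%:R => uL u0E u1E eqn [//|k] /= kn.
have /andP[t0 tT] := tauT _ n1; rewrite -/tau in t0 tT.
have tauk j : (j <= n.+1)%N -> 0 <= j%:R * tau <= T.
  move=> jn; rewrite mulr_ge0 ?(ltW t0)//= /tau mulrCA ler_piMr ?(ltW T_gt0)//.
  by rewrite ler_pdivrMr ?ltr0n// mul1r ler_nat.
have growth (g : R -> R) (c' : R) j : (j < n)%N -> c' <= c ->
    (forall t : R, 0 <= t <= T -> 0 <= g t) ->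
    (forall s t : R, 0 <= s -> s <= t -> t <= T -> g t <= (1 + c' * (t - s)) * g s) ->
    g (j.+1%:R * tau) <= (1 + c * tau) * g (j%:R * tau).
  move=> jn cc g0 gg; have /andP[j0 jT] := tauk j (ltnW (leqW jn)).
  have /andP[_ jT'] := tauk j.+1 (leqW jn).
  have jj : j.+1%:R * tau - j%:R * tau = tau by rewrite -mulrBl -natrB// subSnn mul1r.
  apply: le_trans (gg (j%:R * tau) _ j0 _ jT') _.
    by rewrite -subr_ge0 jj ltW.
  by rewrite jj ler_wpM2r ?g0 ?j0// lerD2l ler_wpM2r// ltW.
have := @scheme_energy_bound _ _ _ _ sqrtL_def n tau c `|Fmax|
  (fun j => alpha (j%:R * tau)) (fun j => beta (j%:R * tau))
  (fun j => f (j%:R * tau)) u t0 (addr_ge0 ca0 cb0).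
move=> /(_ _ _ _ _ _ k kn) bound.
set a := alpha (k%:R * tau) in bound; set b := beta (k%:R * tau) in bound.
set E := (X in Num.sqrt X <= _) in bound.
have kT : 0 <= k%:R * tau <= T by apply: tauk; exact: ltnW.
have V0 v : 0 <= half_energy sqrtL v by rewrite mulr_ge0// sqr_ge0.
have [E0 dE VE] := energy_ge (L2norm (tau^-1 *: (u k.+1 - u k)))
  (alpha_ge0 _ kT) (beta_ge0 _ kT) (V0 (u k)) (V0 (u k.+1)).
rewrite -/a -/b -/E in E0 dE VE.
have EK : E <= K ^+ 2.
  rewrite -[E]sqr_sqrtr// lerXn2r ?nnegrE ?sqrtr_ge0// KE.
  apply: le_trans (bound _ _ _ _ _) _.
  - by move=> j jn; split; [apply: alpha_ge0|apply: beta_ge0]; apply: tauk; exact: leqW.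
  - move=> j jn; split; [apply: (growth _ ca)|apply: (growth _ cb)] => //.
      by rewrite lerDl.
    by rewrite lerDr.
  - move=> j jn; apply: le_trans (L2norm_le_sup fcont (tauk _ (leqW jn))) _.
    by rewrite fmax ler_norm.
  - by move=> j jn; exact: uL.
  - by move=> j jn; exact: (eqn j.+1).
  have kt : tau *+ k <= T by rewrite -mulr_natl; case/andP: kT.
  have tF : 0 <= tau * `|Fmax| by rewrite mulr_ge0// ltW.
  apply: ler_pM; first exact: expR_ge0.
  - by rewrite addr_ge0 ?sqrtr_ge0// mulrn_wge0.
  - by rewrite ler_expR -mulrnAr ler_wpM2l// addr_ge0.
  apply: lerD; last by rewrite -mulrnAl ler_wpM2r.
  (* The scheme starts from representatives of u0 and u1, which have the same energy. *)
  apply: ler_wsqrtr.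
  rewrite [X in X <= C](_ : _ = initial_energy sqrtL alpha beta u0 v0 w0 tau).
    by apply: E1C; rewrite t0.
  have d0E : inner (tau^-1 *: (u 1 - u 0)) =
      inner (tau^-1 *: (first_step u0 v0 w0 tau - u0)).
    by apply/funext => w; rewrite !(innerZl, innerBl) (L2eq_inner u0E) (L2eq_inner u1E).
  rewrite mul0r (eq_inner_L2norm d0E).
  rewrite (half_energy_congr saS u0h (esym (L2eq_inner u0E))).
  rewrite (half_energy_congr saS _ (esym (L2eq_inner u1E)))//.
  exists (first_step (app sqrtL u0) (app sqrtL v0) (app sqrtL w0) tau).
  exact: first_step_graph.
split.
  apply: (@le_trans _ _ (2 * K)); last by rewrite lerDl.
  rewrite -(@ler_pXn2r _ 2)// ?nnegrE ?mulr_ge0 ?L2norm_ge0//.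
  rewrite exprMn; have := sqr_ge0 K; lra.
apply: (@le_trans _ _ (2 * K / Num.sqrt m)); last by rewrite lerDl.
rewrite ler_pdivlMr ?sqrtr_gt0// -(@ler_pXn2r _ 2)// ?nnegrE ?mulr_ge0 ?L2norm_ge0 ?sqrtr_ge0//.
rewrite !exprMn sqr_sqrtr ?(ltW m0)//.
have := ler_wpM2r (V0 (u k.+1)) (alpha_ge _ kT); rewrite -/a /half_energy => mV.
rewrite /half_energy in VE; lra.
Qed.
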